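(* Let $b\in\mathbb{C}$, $r\in\mathbb{N}$, $\mathbf{m}=(m_1,\dots,m_r)\in\mathbb{N}^r$, $m=m_1+\cdots+m_r$, $\mathbf{f}=(f_1,\dots,f_r)\in\mathbb{C}^r$. Suppose $q\in\{0,\ldots,m-1\}$, $b+m-q\notin-\mathbb{N}_0$, and $f_j-b\notin\{m-q-m_j,m-q-m_j+1,\ldots,0\}$ for every index $1\le j\le r$ such that $m-q-m_j\le 0$. Then for all $x\in\mathbb{C}$ $$e^{-x}\,{}_{r+1}F_{r+1}\left(\begin{matrix}b,\mathbf{f}+\mathbf{m}\\ b+m-q,\mathbf{f}\end{matrix}\,\middle|\,x\right)=\sum_{j=0}^{q}\frac{(-q)_jQ^{0}_m(-j)}{(b+m-q)_j\,j!}(-x)^j$$ $$+\frac{(-x)^{q+1}R_{m-q-1}(-q-1)}{(b+m-q)_{q+1}(m-q-1)!}\;{}_{m-q}F_{m-q}\left(\begin{matrix}1,\boldsymbol{\lambda}+q+2\\ b+m+1,\boldsymbol{\lambda}+q+1\end{matrix}\,\middle|\,-x\right),$$ where $\boldsymbol{\lambda}=(\lambda_1,\ldots,\lambda_{m-q-1})$ are the zeros of the polynomial $$R_{m-q-1}(t)=\sum_{k=0}^{m}(b)_kC_{k,r}(-1)^k(1-t-k)_{m-q-1},$$ the values $Q_m^0(-j)$, $0\le j\le q$, are $$Q_m^0(-j)=\frac{1}{(-q)_j}\sum_{k=0}^{j}(b)_kC_{k,r}(-j)_k(m-q)_{j-k},$$ and $$R_{m-q-1}(-q-1)=(-1)^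{m-q+1}\sum_{k=0}^{q+1}(b)_kC_{k,r}(-1)^k(k-m)_{m-q-1}.$$
   Context: $\mathbb{N}=\{1,2,\dots\}$, $\mathbb{N}_0=\mathbb{N}\cup\{0\}$; $(z)_k=z(z+1)\cdots(z+k-1)$, $(z)_0=1$. ${}_pF_q$ is the generalized hypergeometric function $\sum_{n\ge0}\frac{(a_1)_n\cdots(a_p)_n}{(b_1)_n\cdots(b_q)_n}\frac{z^n}{n!}$; as usual, no bottom parameter is a nonpositive integer (in particular no $f_j$ is). A vector in a parameter list stands for the list of its components: $\mathbf{f}+\mathbf{m}$ means $f_1+m_1,\dots,f_r+m_r$; $\boldsymbol{\lambda}+s$ means $\lambda_1+s,\dots,\lambda_{m-q-1}+s$ (an empty list if $m-q-1=0$). The coefficients are $C_{k,r}=\frac{(-1)^k}{k!}\,{}_{r+1}F_r\left(\begin{matrix}-k,\mathbf{f}+\mathbf{m}\\ \mathbf{f}\end{matrix}\,\middle|\,1\right)=\frac{(-1)^k}{k!}\sum_{i=0}^k\frac{(-k)_i}{i!}\prod_{j=1}^r\frac{(f_j+m_j)_i}{(f_j)_i}$ for $0\le k\le m$; in particular $C_{0,r}=1$ and $C_{m,r}=1/\prod_{j=1}^r(f_j)_{m_j}$. The polynomial $R_{m-q-1}$ is regarded as a polynomial of degree $m-q-1$, and its zeros $\lambda_1,\dots,\lambda_{m-q-1}$ are such that $R_{m-q-1}(t)=\kappa\prod_{i=1}^{m-q-1}(t-\lambda_i)$ with a nonzero constant $\kappa$. *)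

(* Defs.v *)
(* MathComp-Analysis. The complex numbers are R[i] for R : realType, with the
   norm topology that R[i] carries as a numFieldType. *)
From HB Require Import structures.
From mathcomp Require Import all_boot all_order all_algebra.
From mathcomp Require Import complex.
From mathcomp Require Import boolp classical_sets reals topology normedtype.
From mathcomp Require Import sequences.
Set Implicit Arguments.
Unset Strict Implicit.
Unset Printing Implicit Defensive.
Import Order.TTheory GRing.Theory Num.Theory.
Import numFieldNormedType.Exports.
Local Open Scope ring_scope.

(* The rising factorial (z)_n. *)
Definition poch (A : pzRingType) (z : A) (n : nat) : A :=
  \prod_(i < n) (z + i%:R).

(* z \in -N_0 = {0, -1, -2, ...} *)
Definition nonpos_int (A : pzRingType) (z : A) : Prop :=
  exists n : nat, z = - n%:R.

Definition pFq_coeff (K : fieldType) (a b : seq K) (n : nat) : K :=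
  (\prod_(c <- a) poch c n) / (\prod_(d <- b) poch d n) / n`!%:R.

(* Meaningful when no element of b is a nonpositive integer (division by 0
   yields 0) and when the series converges. *)
Definition pFq (K : numFieldType) (a b : seq K) (z : K) : K :=
  limn (series (fun n => pFq_coeff a b n * z ^+ n)).

(* The library's expR is restricted to real arguments; this is the same power
   series over any numFieldType, in particular over R[i]. *)
Definition expC (K : numFieldType) (z : K) : K :=
  limn (series (fun n => z ^+ n / n`!%:R)).

Section Coefficients.
Variables (K : fieldType) (r : nat) (f : 'I_r -> K) (ms : 'I_r -> nat).

(* C_{k,r}, with the terminating hypergeometric series at 1 written as a finite
   sum; see millerC_pFq below. *)
Definition millerC (k : nat) : K :=
  (-1) ^+ k / k`!%:R *
  \sum_(i < k.+1) poch (- k%:R) i / i`!%:R *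
    \prod_(j < r) (poch (f j + (ms j)%:R) i / poch (f j) i).

(* R_{m-q-1}, as a formal polynomial in t = 'X. *)
Definition Rpoly (b : K) (m q : nat) : {poly K} :=
  \sum_(k < m.+1) (poch b k * millerC k * (-1) ^+ k) *:
    poch (1 - 'X - k%:R : {poly K}) (m - q - 1).

(* The value Q^0_m(-j), for j <= q (so that (-q)_j != 0). *)
Definition Qval (b : K) (m q j : nat) : K :=
  (poch (- q%:R) j)^-1 *
  \sum_(k < j.+1) poch b k * millerC k * poch (- j%:R) k *
    poch (m - q)%:R (j - k).

End Coefficients.

Lemma millerC_pFq (K : numFieldType) (r : nat) (f : 'I_r -> K)
    (ms : 'I_r -> nat) (k : nat) :
  millerC f ms k = (-1) ^+ k / k`!%:R *
    pFq (- k%:R :: [seq f j + (ms j)%:R | j : 'I_r]) [seq f j | j : 'I_r] 1.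
Proof.
have prodE (g : 'I_r -> K) : \prod_(j in 'I_r) g j = \prod_(j < r) g j.
  exact: eq_bigl.
rewrite /millerC /pFq; congr (_ * _); apply/esym/cvg_lim.
  exact: norm_hausdorff.
apply: cvg_near_cst; exists k.+1 => // n /= kn.
rewrite /series/= (big_cat_nat (n := k.+1))//= [X in _ + X]big_nat_cond.
rewrite [X in _ + X]big1 ?addr0 => [|i].
  rewrite big_mkord; apply: eq_bigr => i _.
  rewrite /pFq_coeff expr1n mulr1 big_cons !big_image/= !prodE prodf_div.
  by rewrite mulrAC -!mulrA [X in _ * X]mulrA [X in _ * (X * _)]mulrC -!mulrA.
rewrite andbT => /andP[ki _]; rewrite /pFq_coeff big_cons.
by rewrite {1}/poch (bigD1 (Ordinal ki))//= addNr !mul0r.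
Qed.

(* Main.v *)
(** By Newton interpolation the ratio [prod_j (f_j + m_j)_n / (f_j)_n], a
    polynomial of degree [m] in [n], equals [sum_k C_{k,r} n (n-1) ... (n-k+1)].
    The Cauchy product of the two series on the left therefore has [(-x)^N]
    coefficient an alternating binomial sum, which the Chu-Vandermonde identity
    (the coefficient form of Kummer's transformation) turns into
    [1 / ((c)_N N!) * sum_k (b)_k C_{k,r} (-N)_k (m-q)_(N-k)], where
    [c = b + m - q].  For [N <= q] this is the stated term in [Q^0_m(-N)]; for
    [N > q] it is [R_{m-q-1}(-N) / ((c)_N (m-q-1)!)], and factoring [R_{m-q-1}]
    over its zeros turns the tail of the series into the
    [_{m-q}F_{m-q}] on the right. *)
Require Import Defs.
From mathcomp Require Import all_boot all_order all_algebra.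
From mathcomp Require Import complex reals.
From mathcomp Require Import ring zify.
From mathcomp Require Import boolp classical_sets topology normedtype.
From mathcomp Require Import sequences.
Set Implicit Arguments.
Unset Strict Implicit.
Unset Printing Implicit Defensive.
Import Order.TTheory GRing.Theory Num.Theory.
Import numFieldNormedType.Exports.
Local Open Scope ring_scope.

(** * Rising factorials and alternating binomial sums *)

Lemma poch0 (A : pzRingType) (z : A) : poch z 0 = 1.
Proof. exact: big_ord0. Qed.

Lemma pochS (A : pzRingType) (z : A) n : poch z n.+1 = poch z n * (z + n%:R).
Proof. exact: big_ord_recr. Qed.

Lemma pochD (A : pzRingType) (z : A) m n :
  poch z (m + n) = poch z m * poch (z + m%:R) n.
Proof.
elim: n => [|n IH]; first by rewrite addn0 poch0 mulr1.
by rewrite addnS !pochS IH natrD addrA mulrA.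
Qed.

Lemma pochSl (A : pzRingType) (z : A) n : poch z n.+1 = z * poch (z + 1) n.
Proof. by rewrite -add1n pochD pochS poch0 mul1r addr0. Qed.

Lemma poch_neq0 (K : fieldType) (c : K) n : ~ nonpos_int c -> poch c n != 0.
Proof.
move=> hc; apply/prodf_neq0 => i _; apply/eqP => /eqP.
by rewrite addr_eq0 => /eqP ci; apply: hc; exists i.
Qed.

Lemma nonpos_intD (A : pzRingType) (c : A) n :
  ~ nonpos_int c -> ~ nonpos_int (c + n%:R).
Proof.
move=> hc [k ck]; apply: hc; exists (k + n)%N.
by rewrite natrD opprD -ck addrK.
Qed.

Lemma poch_nat (A : comPzRingType) a n :
  a`!%:R * poch a.+1%:R n = (a + n)`!%:R :> A.
Proof.
elim: n => [|n IH]; first by rewrite poch0 mulr1 addn0.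
by rewrite pochS mulrA IH -natrD addSn addnS factS mulnC natrM.
Qed.

Lemma poch_opp (A : comPzRingType) (z : A) n :
  poch (- z) n = (-1) ^+ n * poch (z + 1 - n%:R) n.
Proof.
elim: n z => [|n IH] z; first by rewrite !poch0 mulr1.
rewrite pochS IH pochSl -[n.+1]addn1 natrD.
rewrite (_ : z + 1 - (n%:R + 1) + 1 = z + 1 - n%:R); last by ring.
by rewrite exprD expr1; ring.
Qed.

Lemma poch_oppn (A : comPzRingType) N k :
  poch (- N%:R) k = (-1) ^+ k * (k`! * 'C(N, k))%:R :> A.
Proof.
rewrite mulnC bin_ffact; elim: k => [|k IH].
  by rewrite poch0 mul1r ffactn0.
rewrite pochS IH ffactnSr exprS; have [kN|Nk] := leqP k N.
  by rewrite natrM natrB//; ring.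
by rewrite ffact_small//= !mul0n !mulr0 mul0r.
Qed.

Lemma poch_oppn_eq0 (A : comPzRingType) N k :
  (N < k)%N -> poch (- N%:R) k = 0 :> A.
Proof. by move=> Nk; rewrite poch_oppn bin_small// muln0 mulr0. Qed.

(** Up to the sign [(-1) ^+ n], the [n]-th forward difference of [F] at 0. *)
Definition alt_binom_sum (A : pzRingType) (F : nat -> A) (n : nat) : A :=
  \sum_(j < n.+1) (-1) ^+ j * 'C(n, j)%:R * F j.

Lemma eq_alt_binom_sum (A : pzRingType) (F G : nat -> A) n :
  (forall j, (j <= n)%N -> F j = G j) -> alt_binom_sum F n = alt_binom_sum G n.
Proof. by move=> FG; apply: eq_bigr => j _; rewrite FG ?leq_ord. Qed.

Lemma alt_binom_sumZ (A : comPzRingType) (a : A) (F : nat -> A) n :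
  alt_binom_sum (fun j => a * F j) n = a * alt_binom_sum F n.
Proof.
by rewrite /alt_binom_sum mulr_sumr; apply: eq_bigr => j _; rewrite mulrCA.
Qed.

(** Pascal's rule; this recursion drives the inductions on [n] below. *)
Lemma alt_binom_sumS (A : comPzRingType) (F : nat -> A) n :
  alt_binom_sum F n.+1 = alt_binom_sum (fun j => F j - F j.+1) n.
Proof.
rewrite /alt_binom_sum big_ord_recl/= bin0.
under eq_bigr => j _ do rewrite /bump add1n binS natrD mulrDr mulrDl.
rewrite big_split/= addrA.
under [RHS]eq_bigr => j _ do rewrite mulrBr.
rewrite sumrB; congr (_ + _).
  rewrite [RHS]big_ord_recl/= bin0; congr (_ + _).
  by rewrite big_ord_recr/= bin_small// mulr0 mul0r addr0.
by rewrite -sumrN; apply: eq_bigr => j _; rewrite exprS; ring.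
Qed.

(** Binomial inversion: by the recursion, [alt_binom_sum F j - alt_binom_sum F j.+1] is the same sum
    for the shifted [F], to which the induction hypothesis applies. *)
Lemma alt_binom_sumK (A : comPzRingType) (F : nat -> A) n :
  alt_binom_sum (alt_binom_sum F) n = F n.
Proof.
elim: n F => [|n IH] F.
  by rewrite /alt_binom_sum !big_ord1 /= !mul1r.
rewrite alt_binom_sumS -(IH (fun j => F j.+1)); apply: eq_alt_binom_sum => j _.
rewrite alt_binom_sumS /alt_binom_sum -sumrB; apply: eq_bigr => i _.
by ring.
Qed.

(** Each differencing step replaces [p] by [p - p(X + 1)], which has lower degree because the
    leading coefficients cancel. *)
Lemma alt_binom_sum_poly (A : idomainType) (p : {poly A}) n :
  (size p <= n)%N -> alt_binom_sum (fun j => p.[j%:R]) n = 0.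
Proof.
elim: n p => [|n IH] p.
  rewrite leqn0 size_poly_eq0 => /eqP->.
  by rewrite /alt_binom_sum big_ord1 horner0 mulr0.
move=> sz; rewrite alt_binom_sumS -[RHS](IH (p - (p \Po ('X + 1%:P)))).
  apply: eq_alt_binom_sum => j _.
  by rewrite /= hornerD hornerN horner_comp !hornerE -natr1.
have [->|p0] := eqVneq p 0; first by rewrite comp_poly0 subrr size_poly0.
have sX : size ('X + 1%:P : {poly A}) = 2 by rewrite size_XaddC.
have sc := size_comp_poly2 p sX.
rewrite -ltnS; apply: leq_trans sz.
have sp : (0 < size p)%N by rewrite size_poly_gt0.
rewrite -(prednK sp) ltnS; apply/leq_sizeP => i.
rewrite leq_eqVlt => /orP[/eqP<-|]; last first.
  by rewrite prednK// => ij; rewrite coefB !nth_default ?subr0 ?sc.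
rewrite coefB -{2}sc -!/(lead_coef _) lead_coef_comp ?sX// lead_coefXaddC.
by rewrite expr1n mulr1 subrr.
Qed.

Lemma mul_bin_bin k l i : (i <= l)%N ->
  ('C(k + l, k + i) * 'C(k + i, k) = 'C(k + l, k) * 'C(l, i))%N.
Proof.
move=> il.
have := bin_fact (_ : k + i <= k + l)%N; rewrite leq_add2l subnDl => /(_ il) h1.
have := bin_fact (leq_addr i k); rewrite addKn => h2.
have := bin_fact (leq_addr l k); rewrite addKn => h3.
have h4 := bin_fact il.
apply/eqP; rewrite -(eqn_pmul2r (fact_gt0 k)) -(eqn_pmul2r (fact_gt0 i)).
rewrite -(eqn_pmul2r (fact_gt0 (l - i))); apply/eqP.
transitivity (k + l)`!; first by rewrite -h1 -h2; ring.
by rewrite -h3 -h4; ring.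
Qed.

(** Terms with [j < k] vanish; in the others [mul_bin_bin] pulls ['C(k + l, k)] out of the sum. *)
Lemma alt_binom_sum_bin (A : comPzRingType) (F : nat -> A) k l :
  alt_binom_sum (fun j => 'C(j, k)%:R * F j) (k + l) =
  (-1) ^+ k * 'C(k + l, k)%:R * alt_binom_sum (fun j => F (k + j)%N) l.
Proof.
rewrite /alt_binom_sum -addnS big_split_ord /= big1 => [|i _]; last first.
  by rewrite (bin_small (ltn_ord i)) mul0r mulr0.
rewrite add0r mulr_sumr; apply: eq_bigr => -[i /= il] _.
have /(congr1 (fun x => x%:R : A)) := mul_bin_bin k (il : (i <= l)%N).
rewrite !natrM exprD => E.
transitivity ((-1) ^+ k * (-1) ^+ i * F (k + i)%N *
  ('C(k + l, k + i)%:R * 'C(k + i, k)%:R)); first by ring.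
by rewrite E; ring.
Qed.

(* Chu-Vandermonde, multiplied by [poch c n] to avoid division. *)
Lemma alt_binom_sum_poch (A : comPzRingType) (b c : A) n :
  alt_binom_sum (fun j => poch b j * poch (c + j%:R) (n - j)) n =
  poch (c - b) n.
Proof.
elim: n c => [|n IH] c.
  by rewrite /alt_binom_sum big_ord1 !poch0 /= !mulr1.
(* Consecutive summands share [poch b j * poch (c + 1 + j) (n - j)], and the remaining factor is
   [(c + j) - (b + j) = c - b]; the induction hypothesis is used at [c + 1]. *)
rewrite alt_binom_sumS pochSl [c - b + 1]addrAC -IH /alt_binom_sum mulr_sumr.
apply: eq_bigr => -[j /= jn] _; rewrite subSS subSn// pochSl pochS -natr1.
rewrite -!addrA [1 + _]addrC; ring.
Qed.

(** * The coefficients C_{k,r} and the polynomial R_{m-q-1} *)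

Definition miller_ratio (K : fieldType) r (f : 'I_r -> K) (ms : 'I_r -> nat)
    (n : nat) : K :=
  \prod_(j < r) (poch (f j + (ms j)%:R) n / poch (f j) n).

Section MillerCoefficients.
Variables (K : numFieldType) (r : nat) (f : 'I_r -> K) (ms : 'I_r -> nat).
Hypothesis hf : forall j, ~ nonpos_int (f j).

Lemma fact_neq0 n : n`!%:R != 0 :> K.
Proof. by rewrite pnatr_eq0 -lt0n fact_gt0. Qed.

(** Since [(-k)_i / i! = (-1)^i 'C(k, i)], the number [k! C_{k,r}] is the [k]-th forward difference
    of the ratio at 0. *)
Lemma millerC_alt_binom_sum k :
  k`!%:R * millerC f ms k = (-1) ^+ k * alt_binom_sum (miller_ratio f ms) k.
Proof.
rewrite /millerC mulrA; congr (_ * _).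
  by rewrite mulrCA divff ?mulr1 ?fact_neq0.
apply: eq_bigr => i _; rewrite poch_oppn natrM mulrA; congr (_ * _).
by field; exact: fact_neq0.
Qed.

(** Newton's forward difference formula, read off from binomial inversion. *)
Lemma miller_ratio_newton n :
  miller_ratio f ms n =
  \sum_(k < n.+1) 'C(n, k)%:R * (k`!%:R * millerC f ms k).
Proof.
rewrite -[LHS]alt_binom_sumK; apply: eq_bigr => k _.
by rewrite millerC_alt_binom_sum; ring.
Qed.

(** On the naturals the ratio agrees with a polynomial of degree at most [m], whose differences of
    higher order vanish. *)
Lemma millerC_eq0 k : (\sum_(j < r) ms j < k)%N -> millerC f ms k = 0.
Proof.
move=> mk; apply: (mulfI (fact_neq0 k)).
(* Splitting [(f_j)_(m_j + n)] in both ways gives [(f_j + m_j)_n / (f_j)_n = (f_j + n)_(m_j) /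
   (f_j)_(m_j)], polynomial in [n]. *)
pose p : {poly K} := \prod_(j < r)
  ((poch (f j) (ms j))^-1 *: \prod_(i < ms j) ('X + (f j + i%:R)%:P)).
rewrite millerC_alt_binom_sum mulr0 (@eq_alt_binom_sum _ _ (fun n => p.[n%:R])).
  rewrite alt_binom_sum_poly ?mulr0//; apply: leq_trans mk.
  rewrite /p; elim/big_ind2: _ => [|s1 p1 s2 p2 h1 h2|j _].
  - by rewrite size_poly1.
  - apply: leq_trans (size_polyMleq _ _) _.
    by rewrite -ltnS; lia.
  - apply: leq_trans (size_scale_leq _ _) _.
    under eq_bigr => i _ do rewrite -[_%:P]opprK -polyCN.
    by rewrite -big_enum size_prod_XsubC size_enum_ord.
move=> n _; rewrite /p horner_prod; apply: eq_bigr => j _.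
rewrite hornerZ horner_prod.
have -> : \prod_(i < ms j) ('X + (f j + i%:R)%:P).[n%:R] =
    poch (f j + n%:R) (ms j).
  by apply: eq_bigr => i _; rewrite hornerD hornerX hornerC addrCA addrA.
have := pochD (f j) (ms j) n; rewrite addnC pochD => E.
by field: E; rewrite !poch_neq0.
Qed.

(** Newton's formula inserts ['C(j, k)], which [alt_binom_sum_bin] trades for a shift of both [b]
    and [c] by [k]; Chu-Vandermonde then applies with [c - b] unchanged. *)
Lemma alt_binom_sum_miller (b c : K) n : ~ nonpos_int c ->
  alt_binom_sum (fun j => poch b j / poch c j * miller_ratio f ms j) n =
  (poch c n)^-1 * \sum_(k < n.+1)
    poch b k * millerC f ms k * poch (- n%:R) k * poch (c - b) (n - k).
Proof.
move=> hc.
transitivity (\sum_(k < n.+1) k`!%:R * millerC f ms k *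
    alt_binom_sum (fun j => 'C(j, k)%:R * (poch b j / poch c j)) n).
  under [RHS]eq_bigr => k _ do rewrite /alt_binom_sum mulr_sumr.
  rewrite exchange_big/=; apply: eq_bigr => -[j /= jn] _.
  rewrite miller_ratio_newton mulr_sumr mulr_sumr.
  (* The Newton sum may run up to [n], since ['C(j, k) = 0] for [k > j]. *)
  rewrite (big_ord_widen _ (fun k => (-1) ^+ j * 'C(n, j)%:R *
    (poch b j / poch c j * ('C(j, k)%:R * (k`!%:R * millerC f ms k)))) jn).
  rewrite big_mkcond/=; apply: eq_bigr => k _; case: ltnP => kj; first by ring.
  by rewrite (bin_small kj) !(mul0r, mulr0).
rewrite mulr_sumr; apply: eq_bigr => -[k /=]; rewrite ltnS => kn _.
rewrite -[in LHS](subnKC kn) alt_binom_sum_bin subnKC//.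
(* Over the common denominator [poch c n], the terms take the division-free shape of
   [alt_binom_sum_poch]. *)
rewrite (@eq_alt_binom_sum _ _ (fun j => poch b k / poch c n *
   (poch (b + k%:R) j * poch (c + k%:R + j%:R) (n - k - j)))); last first.
  move=> j jnk; rewrite !pochD.
  have -> : poch c n =
      poch c k * poch (c + k%:R) j * poch (c + k%:R + j%:R) (n - k - j).
    by rewrite -mulrA -!pochD; congr poch; lia.
  field.
  by rewrite -addrA -natrD !poch_neq0//; exact: nonpos_intD.
rewrite alt_binom_sumZ alt_binom_sum_poch.
rewrite (_ : c + k%:R - (b + k%:R) = c - b); last by ring.
rewrite poch_oppn natrM.
have gen (x1 x2 x3 x4 x5 x6 x7 : K) : x7 * x1 * (x5 * x6 * (x2 * x3 * x4)) =
  x3 * (x2 * x1 * (x5 * (x7 * x6)) * x4) by ring.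
exact: gen.
Qed.

End MillerCoefficients.

Lemma horner_Rpoly (K : fieldType) r (f : 'I_r -> K) (ms : 'I_r -> nat)
    b m q t :
  (Rpoly f ms b m q).[t] = \sum_(k < m.+1)
    poch b k * millerC f ms k * (-1) ^+ k * poch (1 - t - k%:R) (m - q - 1).
Proof.
rewrite /Rpoly horner_sum; apply: eq_bigr => k _.
rewrite hornerZ; congr (_ * _).
rewrite /poch horner_prod; apply: eq_bigr => i _.
by rewrite -!polyC_natr !hornerE.
Qed.

Lemma Rpoly_first_tail (K : fieldType) r (f : 'I_r -> K) (ms : 'I_r -> nat)
    b m q :
  (q < m)%N ->
  (Rpoly f ms b m q).[- q%:R - 1] =
    (-1) ^+ (m - q + 1) *
    \sum_(k < q.+2) poch b k * millerC f ms k * (-1) ^+ k *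
      poch (k%:R - m%:R) (m - q - 1).
Proof.
move=> qm; rewrite horner_Rpoly.
rewrite (big_ord_widen m.+1 (fun k => poch b k * millerC f ms k * (-1) ^+ k *
      poch (k%:R - m%:R) (m - q - 1))) ?ltnS// mulr_sumr [RHS]big_mkcond/=.
apply: eq_bigr => -[k /=]; rewrite ltnS => km _.
have E1 : 1 - (- q%:R - 1) - k%:R = q.+2%:R - k%:R :> K.
  by rewrite -addn2 natrD; ring.
case: ltnP => kq.
  rewrite -[k%:R - m%:R]opprB poch_opp E1.
  have -> : (m%:R - k%:R + 1 - (m - q - 1)%:R : K) = q.+2%:R - k%:R.
    by rewrite -subnDA addn1 natrB// -[in RHS]natr1; ring.
  rewrite [RHS]mulrCA; congr (_ * _).
  (* The reflection contributes [(-1)^(m - q - 1)], so with the prefactor the exponent is even. *)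
  rewrite mulrA -exprD (_ : _ + _ = (m - q).*2)%N; last by rewrite -addnn; lia.
  by rewrite -mul2n exprM sqrrN expr1n expr1n mul1r.
(* For [q + 2 <= k <= m] the product of [m - q - 1] factors starts at [-(k - q - 2)] and passes
   through 0. *)
rewrite E1 (_ : _ - _ = - (k - q.+2)%:R); last by rewrite natrB// opprB.
by rewrite poch_oppn_eq0 ?mulr0//; lia.
Qed.

(** The sums agree term by term after extending both to [k <= N + m]: [C_{k,r} = 0] for [k > m], and
    for [N < k <= m] the rising factorial in [R] has a zero factor because [q < N]. *)
Lemma Rpoly_tail (K : numFieldType) r (f : 'I_r -> K) (ms : 'I_r -> nat) b q N :
  (forall j, ~ nonpos_int (f j)) ->
  let m := (\sum_(j < r) ms j)%N in (q < m)%N -> (q < N)%N ->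
  (\sum_(k < N.+1)
     poch b k * millerC f ms k * poch (- N%:R) k * poch (m - q)%:R (N - k)) /
  N`!%:R = (Rpoly f ms b m q).[- N%:R] / (m - q - 1)`!%:R.
Proof.
move=> hf m qm qN; rewrite horner_Rpoly !mulr_suml.
have widen (F : nat -> K) n : (n <= N + m)%N ->
    \sum_(k < n.+1) F k = \sum_(k < (N + m).+1) if (k < n.+1)%N then F k else 0.
  by move=> nNm; rewrite (@big_ord_widen _ _ _ _ (N + m).+1)// big_mkcond.
rewrite (widen (fun k => poch b k * millerC f ms k * poch (- N%:R) k *
  poch (m - q)%:R (N - k) / N`!%:R)) ?leq_addr//.
rewrite [RHS](widen (fun k => poch b k * millerC f ms k * (-1) ^+ k *
  poch (1 - - N%:R - k%:R) (m - q - 1) / (m - q - 1)`!%:R)) ?leq_addl//.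
apply: eq_bigr => -[k /= _] _; rewrite !ltnS.
case: (leqP k m) => km; last first.
  by rewrite millerC_eq0// mulr0 !mul0r; case: ifP.
rewrite opprK; case: leqP => kN; last first.
  rewrite (_ : 1 + N%:R - k%:R = - (k - N.+1)%:R).
    by rewrite poch_oppn_eq0 ?mulr0 ?mul0r//; lia.
  by rewrite natrB// -natr1; ring.
have -> : 1 + N%:R - k%:R = (N - k).+1%:R :> K.
  by rewrite -natr1 natrB//; ring.
(* Two factorizations of [(N - k + m - q - 1)!] relate the rising factorials on the two sides. *)
have h1 := poch_nat K (N - k) (m - q - 1).
have := poch_nat K (m - q - 1) (N - k).
rewrite addnC -h1 (_ : (m - q - 1).+1 = m - q)%N; last by lia.
move=> h2; rewrite poch_oppn.
have /(congr1 (fun x => x%:R : K)) := bin_fact kN; rewrite !natrM => h3.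
have := fact_neq0 K N; rewrite -h3.
have p0 := fact_neq0 K (m - q - 1).
rewrite !mulf_eq0 !negb_or => /and3P[y2 y1 y3].
have gen (p a e x1 x2 x3 X Y : K) :
    p != 0 -> x1 != 0 -> x2 != 0 -> x3 != 0 -> p * X = x3 * Y ->
    a * (e * (x1 * x2)) * X / (x2 * (x1 * x3)) = a * e * Y / p.
  by move=> p_0 x1_0 x2_0 x3_0 pX; field: pX; rewrite p_0 x1_0 x2_0 x3_0.
exact: gen.
Qed.

(** * Series dominated by an exponential series *)

(** All the completeness of [R[i]] that is needed; it makes the analysis below
    work over any [numFieldType], where products of limits are available. *)
Definition exp_complete (K : numFieldType) : Prop :=
  forall (u : nat -> K) (M s : K),
    (forall n, `|u n| <= M * (s ^+ n / n`!%:R)) -> cvgn (series u).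

Lemma normc_le_ReIm (R : rcfType) (z : R[i]) :
  `|z| <= (`|complex.Re z| + `|complex.Im z|)%:C%C.
Proof.
case: z => a b /=; rewrite normc_def lecE /= eqxx /=.
rewrite -[leRHS]ger0_norm ?addr_ge0// -(sqrtr_sqr (`|a| + `|b|)).
apply: ler_wsqrtr.
rewrite -(real_normK (num_real a)) -(real_normK (num_real b)) sqrrD.
by rewrite lerD2r lerDl mulrn_wge0// mulr_ge0.
Qed.

Lemma cvg_complex (R : realType) (u : nat -> (R[i] : numFieldType))
    (l : (R[i] : numFieldType)) :
  ((fun n => complex.Re (u n)) @ \oo --> complex.Re l)%classic ->
  ((fun n => complex.Im (u n)) @ \oo --> complex.Im l)%classic ->
  (u @ \oo --> l)%classic.
Proof.
move=> /cvgrPdist_lt uRe /cvgrPdist_lt uIm; apply/cvgrPdist_lt => e.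
rewrite ltcE /= => /andP[/eqP e_im e_gt0].
have e2 : 0 < complex.Re e / 2 by rewrite divr_gt0.
near=> n.
apply: le_lt_trans (normc_le_ReIm _) _.
rewrite ltcE /= e_im eqxx /= !raddfB /= (splitr (complex.Re e)) ltrD//.
  near: n; exact: uRe.
near: n; exact: uIm.
Unshelve. all: by end_near. Qed.

Lemma exp_complete_complex (R : realType) : exp_complete (R[i] : numFieldType).
Proof.
move=> u M s us.
(* [M] and [s] need not be real; the bound itself is real, as it dominates a norm, so moduli may
   replace them. *)
pose M' : R := complex.Re `|M : R[i]|; pose s' : R := complex.Re `|s : R[i]|.
have ReN (z : R[i]) : (complex.Re `|z|)%:C%C = `|z|.
  exact: (RRe_real (normr_real z)).
have ReN0 (z : R[i]) : 0 <= complex.Re `|z|.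
  by have := normr_ge0 z; rewrite lecE => /andP[].
have mulC_exp (x y : R) n :
    (x * exp_coeff y n)%:C%C = x%:C%C * (y%:C%C ^+ n / n`!%:R) :> R[i].
  rewrite /exp_coeff [LHS]rmorphM [X in _ * X]rmorphM.
  by rewrite fmorphV rmorphXn rmorph_nat.
have us' n : `|u n : R[i]| <= (M' * exp_coeff s' n)%:C%C.
  rewrite mulC_exp !ReN -normrX -[X in _ / X]normr_nat -normf_div -normrM.
  apply: le_trans (us n) _.
  by rewrite real_ler_norm// (ger0_real (le_trans _ (us n))).
have cvgMs : cvgn (series (fun n => M' * exp_coeff s' n)).
  exact: (@is_cvg_seriesZ R _ M' (is_cvg_series_exp_coeff s')).
have cvg_part (v : nat -> R) : (forall n, `|v n|%:C%C <= `|u n : R[i]|) ->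
    cvgn (series v).
  move=> vu; apply: (@normed_cvg _ R^o); apply: series_le_cvg cvgMs => n.
  - exact: normr_ge0.
  - by apply: mulr_ge0; [exact: ReN0|exact/exp_coeff_ge0/ReN0].
  - by rewrite -lecR; exact: le_trans (vu n) (us' n).
have cRe : cvgn (series (fun n => complex.Re (u n))).
  by apply: cvg_part => n; exact: normc_ge_Re.
have cIm : cvgn (series (fun n => complex.Im (u n))).
  (* Up to sign, the imaginary part is the real part after multiplication by the imaginary unit, of
     modulus 1. *)
  apply: cvg_part => n; rewrite -normrN -ReiNIm.
  apply: le_trans (normc_ge_Re _) _.
  rewrite normrM [X in _ * X](_ : _ = 1) ?mulr1//.
  by rewrite normc_def/= expr0n expr1n add0r sqrtr1.
apply/cvg_ex; exists ((limn (series (fun n => complex.Re (u n)))) +i*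
  (limn (series (fun n => complex.Im (u n)))))%C.
apply: cvg_complex => /=.
  under eq_fun do rewrite /series/= raddf_sum.
  exact: cRe.
under eq_fun do rewrite /series/= raddf_sum.
exact: cIm.
Qed.

Definition exp_dominated (K : numFieldType) (u : nat -> K) (M s : K) : Prop :=
  forall n, `|u n| <= M * (s ^+ n / n`!%:R).

Definition convolution (K : pzRingType) (u v : nat -> K) (n : nat) : K :=
  \sum_(i < n.+1) u i * v (n - i)%N.

(** The binomial theorem: the bounds multiply like the exponential series of [s] and [t]. *)
Lemma exp_dominated_convolution (K : numFieldType) (u v : nat -> K)
    (M s N t : K) :
  exp_dominated u M s -> exp_dominated v N t ->
  exp_dominated (convolution u v) (M * N) (t + s).
Proof.
move=> us vt n; apply: le_trans (ler_norm_sum _ _ _) _.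
rewrite exprDn mulr_suml mulr_sumr; apply: ler_sum => i _.
rewrite normrM; apply: le_trans (ler_pM _ _ (us i) (vt (n - i)%N)) _ => //.
rewrite le_eqVlt; apply/orP; left; apply/eqP.
have fact_neq0 k : k`!%:R != 0 :> K by rewrite pnatr_eq0 -lt0n fact_gt0.
have /(congr1 (fun k => k%:R : K)) := bin_fact (leq_ord i).
rewrite !natrM -mulr_natr => <-.
have : 'C(n, i)%:R != 0 :> K by rewrite pnatr_eq0 -lt0n bin_gt0 leq_ord.
by move=> ?; field; rewrite !fact_neq0.
Qed.

(** The product of the partial sums differs from the partial sum of the convolution only by terms of
    index [n] to [2n - 1], bounded by a block of the convergent series [e]. *)
Lemma cvg_series_convolution (K : numFieldType) (u v : nat -> K) (M s N t : K) :
  exp_complete K -> exp_dominated u M s -> exp_dominated v N t ->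
  (series (convolution u v) @ \oo -->
     limn (series u) * limn (series v))%classic.
Proof.
move=> hK us vt.
pose e n : K := M * N * ((t + s) ^+ n / n`!%:R).
(* Coefficients of the product of the truncated polynomials are convolutions of truncated sequences,
   which keep their bounds. *)
pose trunc (w : nat -> K) n i := if (i < n)%N then w i else 0.
have trunc_dom w B x n : exp_dominated w B x -> exp_dominated (trunc w n) B x.
  move=> wx i; rewrite /trunc; case: ifP => // _.
  by rewrite normr0; exact: le_trans (wx i).
pose D n : K := series u n * series v n - series (convolution u v) n.
have D_le n : `|D n| <= series e (n + n)%N - series e n.
  (* [(p * q).[1]] is the product of the partial sums; the coefficients of
     [p * q] below [n] are those of the convolution, and the other ones are
     dominated by [e]. *)
  pose p := \poly_(i < n) u i; pose q := \poly_(i < n) v i.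
  have pq_coef k : (p * q)`_k = convolution (trunc u n) (trunc v n) k.
    by rewrite coefM; apply: eq_bigr => i _; rewrite !coef_poly.
  have hor1 (w : nat -> K) : (\poly_(i < n) w i).[1] = series w n.
    rewrite horner_poly /series/= big_mkord.
    by apply: eq_bigr => i _; rewrite expr1n mulr1.
  have pq1 : series u n * series v n = \sum_(k < n + n) (p * q)`_k.
    rewrite -!hor1 -hornerM (@horner_coef_wide _ (n + n)) -/p -/q.
      by apply: eq_bigr => i _; rewrite expr1n mulr1.
    apply: leq_trans (size_polyMleq _ _) _; apply: leq_trans (leq_pred _) _.
    by rewrite leq_add ?size_poly.
  rewrite sub_series_geq ?leq_addr// /D pq1.
  rewrite -(big_mkord xpredT (fun k => (p * q)`_k)).
  rewrite (@big_cat_nat _ _ _ n) ?leq_addr//=.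
  rewrite (_ : series (convolution u v) n = \sum_(0 <= k < n) (p * q)`_k).
    rewrite addrC addrK; apply: le_trans (ler_norm_sum _ _ _) _.
    apply: ler_sum => k _; rewrite pq_coef.
    have := exp_dominated_convolution (trunc_dom _ _ _ n us).
    by move/(_ _ _ _ (trunc_dom _ _ _ n vt)); exact.
  apply: eq_big_nat => k /andP[_ kn]; rewrite pq_coef; apply: eq_bigr => i _.
  rewrite /trunc (leq_ltn_trans (leq_ord i) kn).
  by rewrite (leq_ltn_trans (leq_subr _ _) kn).
have cu : cvgn (series u) by exact: hK us.
have cv : cvgn (series v) by exact: hK vt.
have ce : cvgn (series e).
  apply: (hK _ (M * N) (t + s)) => n; rewrite ger0_norm//.
  exact: le_trans (exp_dominated_convolution us vt n).
have De0 : (series e (n + n)%N - series e n @[n --> \oo] --> (0 : K))%classic.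
  rewrite -[0 in X in (_ --> X)%classic](subrr (limn (series e))).
  apply: cvgB => //; apply: cvg_comp ce => //.
  apply/cvgnyPge => k; near=> n; apply: leq_trans (leq_addr _ _).
  by near: n; exists k.
have D0 : (D @ \oo --> (0 : K))%classic.
  move/cvgr0Pnorm_lt: De0 => De0; apply/cvgr0Pnorm_lt => x x0.
  near=> n; apply: le_lt_trans (D_le n) _.
  by rewrite -[ltLHS]ger0_norm ?(le_trans _ (D_le n))//; near: n; exact: De0.
rewrite -[_ * _]subr0.
rewrite (_ : series _ = (fun n => series u n * series v n - D n)).
  by apply: cvgB => //; exact: cvgM.
by apply/funext => n; rewrite /D opprB addrC subrK.
Unshelve. all: by end_near. Qed.

(* Otherwise [`|x| ^+ n / n`! >= 1] for all [n], so the series diverges. *)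
Lemma exp_complete_archi (K : numFieldType) (x : K) :
  exp_complete K -> exists N : nat, `|x| <= N%:R.
Proof.
move=> hK.
have : cvgn (series (fun n => `|x| ^+ n / n`!%:R)).
  by apply: (hK _ 1 `|x|) => n; rewrite mul1r ger0_norm ?divr_ge0 ?exprn_ge0.
move=> /cvg_series_cvg_0/cvgr0Pnorm_lt/(_ 1 ltr01) small.
(* Any positive [n] whose term is below 1 serves: [n < |x|] would give [n! <= n^n <= |x|^n]. *)
near (\oo)%classic => n; exists n.
have n_gt0 : (0 < n)%N by near: n; exists 1%N.
have : `| `|x| ^+ n / n`!%:R| < 1 by near: n; exact: small.
rewrite ger0_norm ?divr_ge0 ?exprn_ge0// ltr_pdivrMr ?ltr0n ?fact_gt0// mul1r.
have fact_le k : (k <= n)%N -> (k`! <= n ^ k)%N.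
  by elim: k => // k IH kn; rewrite factS expnS leq_mul// IH// ltnW.
move=> xn; rewrite real_leNgt ?realn//; apply/negP => nx.
suff /(lt_le_trans xn) : n`!%:R <= `|x| ^+ n by rewrite ltxx.
apply: le_trans (_ : (n ^ n)%:R <= _); first by rewrite ler_nat fact_le.
by rewrite natrX lerXn2r ?nnegrE ?ler0n ?normr_ge0 ?(ltW nx).
Unshelve. all: by end_near. Qed.

(** Each factor is [(a + i) / (c + i) = 1 + (a - c) / (c + i)], and [1 / (c + i)] is bounded
    uniformly in [i]. *)
Lemma poch_ratio_bounded (K : numFieldType) (a c : K) :
  exp_complete K -> ~ nonpos_int c ->
  exists2 s : K, 0 <= s & forall n, `|poch a n / poch c n| <= s ^+ n.
Proof.
move=> hK hc.
have cn0 n : c + n%:R != 0.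
  by apply/eqP => cn; apply: hc; exists n; apply/eqP; rewrite -addr_eq0 cn.
have [N cN] := exp_complete_archi (`|c| + 1) hK.
(* The sum covers the indices below [N]; from [N] on, [|c + n| >= 1] and the summand 1 suffices. *)
pose B : K := 1 + \sum_(i < N) `|c + i%:R|^-1.
have B_bound n : `|c + n%:R|^-1 <= B.
  have [nN|Nn] := ltnP n N.
    rewrite /B (bigD1 (Ordinal nN))//= addrCA lerDl addr_ge0 ?sumr_ge0// => i _.
    by rewrite invr_ge0.
  apply: (@le_trans _ _ 1); last first.
    by rewrite lerDl sumr_ge0// => i _; rewrite invr_ge0.
  rewrite invf_le1 ?normr_gt0//.
  rewrite -(lerD2l `|c|); apply: le_trans (_ : n%:R <= _).
    rewrite -[leLHS]ger0_norm ?addr_ge0//.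
    by apply: le_trans cN _; rewrite ler_nat.
  rewrite -[leLHS]normr_nat -[X in `|X| <= _](addKr c).
  by rewrite -[`|c|]normrN ler_normD.
have B_ge0 : 0 <= B by apply: le_trans (B_bound 0%N); rewrite invr_ge0.
exists (1 + `|a - c| * B) => [|n]; first by rewrite addr_ge0 ?mulr_ge0.
rewrite /poch -prodf_div normr_prod -[n in _ ^+ n]card_ord -prodr_const.
apply: ler_prod => i _; rewrite normr_ge0/=.
rewrite (_ : (a + _) / _ = 1 + (a - c) / (c + i%:R)); last first.
  by field; rewrite cn0.
apply: le_trans (ler_normD _ _) _; rewrite normr1 lerD2l normf_div.
by rewrite ler_wpM2l.
Qed.

(** Upper and lower parameters are paired, each pair giving a geometric bound; the remaining [n!]
    makes the bound exponential. *)
Lemma pFq_exp_dominated (K : numFieldType) (a b : seq K) (z : K) :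
  exp_complete K -> size a = size b -> {in b, forall d, ~ nonpos_int d} ->
  exists M s, exp_dominated (fun n => pFq_coeff a b n * z ^+ n) M s.
Proof.
move=> hK sz hb; exists 1.
suff [s s0 hs] : exists2 s : K, 0 <= s & forall n,
    `|(\prod_(c <- a) poch c n) / (\prod_(d <- b) poch d n)| <= s ^+ n.
  exists (s * `|z|) => n; rewrite mul1r /pFq_coeff normrM normrX normf_div.
  rewrite normr_nat mulrAC exprMn.
  by rewrite ler_pM ?mulr_ge0 ?invr_ge0 ?exprn_ge0 ?ler_wpM2r ?exprn_ge0.
move: a b sz hb; apply: seq_ind2 => [|c d a b sz IH] hb.
  by exists 1 => // n; rewrite !big_nil divr1 normr1 expr1n.
have [|s s0 hs] := IH; first by move=> x xb; apply: hb; rewrite inE xb orbT.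
have [t t0 ht] := poch_ratio_bounded c hK (hb d (mem_head _ _)).
exists (t * s) => [|n]; first exact: mulr_ge0.
by rewrite !big_cons -mulf_div normrM exprMn ler_pM.
Qed.

(** * Coefficient comparison *)

Lemma exp_dominated_exp (K : numFieldType) (z : K) :
  exp_dominated (fun n => z ^+ n / n`!%:R) 1 `|z|.
Proof. by move=> n; rewrite mul1r normf_div normrX normr_nat. Qed.

Lemma pFq_coeff_miller (K : fieldType) r (f : 'I_r -> K) (ms : 'I_r -> nat)
    b c n :
  pFq_coeff (b :: [seq f j + (ms j)%:R | j : 'I_r])
            (c :: [seq f j | j : 'I_r]) n =
  poch b n / poch c n * miller_ratio f ms n / n`!%:R.
Proof.
rewrite /pFq_coeff !big_cons !big_image/= -mulf_div; congr (_ * _ / _).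
by rewrite /miller_ratio prodf_div.
Qed.

(** Factoring [(-x)^n] out leaves [(-1)^j] on the [j]-th term, and [n! / (j! (n - j)!)] supplies the
    binomial. *)
Lemma convolution_exp (K : numFieldType) (F : nat -> K) x n :
  convolution (fun k => F k / k`!%:R * x ^+ k)
              (fun k => (- x) ^+ k / k`!%:R) n =
  (- x) ^+ n / n`!%:R * alt_binom_sum F n.
Proof.
rewrite /convolution mulr_sumr; apply: eq_bigr => j _.
have xE : (- x) ^+ n = (-1) ^+ j * x ^+ j * (- x) ^+ (n - j).
  by rewrite -exprMn mulN1r -exprD subnKC ?leq_ord.
have /(congr1 (fun k => k%:R : K)) := bin_fact (leq_ord j).
rewrite !natrM => bE.
have sq1 : (-1) ^+ j * (-1) ^+ j = 1 :> K.
  by rewrite -exprMn mulrNN mulr1 expr1n.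
rewrite xE; have := fact_neq0 K n; rewrite -bE.
move: sq1 ((- x) ^+ _) (x ^+ j) (F j).
move: ((-1) ^+ j) (j`!%:R : K) ('C(n, j)%:R : K) ((n - j)`!%:R : K).
move=> s y1 y2 y3 sq1 z1 z2 z3.
rewrite !mulf_eq0 !negb_or => /and3P[y2_0 y1_0 y3_0].
by field: sq1; rewrite y2_0 y1_0 y3_0.
Qed.

(** Both cross products equal [(z)_(n + 1)], peeled at its first or its last factor. *)
Lemma poch_shift_ratio (K : fieldType) (z : K) n : ~ nonpos_int z ->
  poch (z + 1) n / poch z n = (z + n%:R) / z.
Proof.
move=> hz; have z0 : z != 0.
  by have := poch_neq0 1 hz; rewrite pochS poch0 mul1r addr0.
apply/eqP; rewrite eqr_div ?poch_neq0//.
by rewrite mulrC -pochSl pochS mulrC.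
Qed.

Lemma kummer_miller (K : numFieldType) (b : K) r (f : 'I_r -> K)
    (ms : 'I_r -> nat) q (m := (\sum_(j < r) ms j)%N)
    (kappa : K) (lam : seq K) (x : K) :
  exp_complete K ->
  (forall j, ~ nonpos_int (f j)) -> (q < m)%N ->
  ~ nonpos_int (b + (m - q)%:R) ->
  Rpoly f ms b m q = kappa *: \prod_(l <- lam) ('X - l%:P) ->
  {in lam, forall l, ~ nonpos_int (l + q.+1%:R)} ->
  expC (- x) *
    pFq (b :: [seq f j + (ms j)%:R | j : 'I_r])
        (b + (m - q)%:R :: [seq f j | j : 'I_r]) x =
  \sum_(j < q.+1)
    poch (- q%:R) j * Qval f ms b m q j /
      (poch (b + (m - q)%:R) j * j`!%:R) * (- x) ^+ j +
  (- x) ^+ q.+1 * (Rpoly f ms b m q).[- q%:R - 1] /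
    (poch (b + (m - q)%:R) q.+1 * (m - q - 1)`!%:R) *
    pFq (1 :: [seq l + q.+2%:R | l <- lam])
        (b + m%:R + 1 :: [seq l + q.+1%:R | l <- lam]) (- x).
Proof.
move=> hK hf qm hc hR hlam; set c := b + (m - q)%:R.
set a1 := b :: _; set b1 := c :: _; set a2 := 1 :: _; set b2 := _ :: _.
(* With this, [(c)_(q + 1 + n)] splits into [(c)_(q + 1)] and the lower-parameter factor
   [(b + m + 1)_n]. *)
have c_shift : b + m%:R + 1 = c + q.+1%:R.
  by rewrite /c -!addrA -natrD natr1; congr (_ + _%:R); lia.
have [M [s us]] : exists M s,
    exp_dominated (fun n => pFq_coeff a1 b1 n * x ^+ n) M s.
  apply: pFq_exp_dominated => //; first by rewrite /= !size_map.
  move=> d; rewrite inE => /orP[/eqP->|]; first exact: hc.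
  by case/mapP => j _ ->; exact: hf.
have [N [t gt]] : exists N t,
    exp_dominated (fun n => pFq_coeff a2 b2 n * (- x) ^+ n) N t.
  apply: pFq_exp_dominated => //; first by rewrite /= !size_map.
  move=> d; rewrite inE => /orP[/eqP->|]; last first.
    by case/mapP => l ll ->; exact: hlam.
  by rewrite c_shift; exact: nonpos_intD.
pose h := convolution (fun n => pFq_coeff a1 b1 n * x ^+ n)
  (fun n => (- x) ^+ n / n`!%:R).
have cvg1 : (series h @ \oo --> pFq a1 b1 x * expC (- x))%classic.
  exact: cvg_series_convolution hK us (exp_dominated_exp (- x)).
have hE n : h n = (- x) ^+ n / n`!%:R * ((poch c n)^-1 * \sum_(k < n.+1)
    poch b k * millerC f ms k * poch (- n%:R) k * poch (m - q)%:R (n - k)).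
  rewrite (_ : (m - q)%:R = c - b); last by rewrite /c addrAC subrr add0r.
  rewrite -(alt_binom_sum_miller f ms b n hc) -convolution_exp.
  by apply: eq_bigr => j _; rewrite pFq_coeff_miller.
set S := \sum_(j < q.+1) _; set T := _ / _.
have h_head : \sum_(0 <= k < q.+1) h k = S.
  rewrite big_mkord; apply: eq_bigr => -[j /=]; rewrite ltnS => jq _.
  (* For [j <= q] the inverse in [Qval] is genuine, so it cancels. *)
  have nz : poch (- q%:R) j != 0 :> K.
    rewrite poch_oppn mulf_neq0 ?signr_eq0 ?natrM//.
    by rewrite mulf_neq0 ?fact_neq0// pnatr_eq0 -lt0n bin_gt0.
  rewrite hE /Qval mulVKf//; set sm := \sum_(k < j.+1) _.
  by rewrite invfM; ring.
(* Each root [l] contributes [(l + q + 1 + n) / (l + q + 1)], a quotient of rising factorials by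
   [poch_shift_ratio]. *)
have Rval n : (Rpoly f ms b m q).[- (q.+1 + n)%:R] =
    (Rpoly f ms b m q).[- q%:R - 1] * \prod_(l <- lam)
      (poch (l + q.+2%:R) n / poch (l + q.+1%:R) n).
  rewrite -opprD natr1 hR !hornerZ !horner_prod -mulrA; congr (_ * _).
  rewrite -big_split/=; apply: eq_big_seq => l ll.
  rewrite -[q.+2]addn1 [(q.+1 + 1)%:R]natrD addrA.
  rewrite poch_shift_ratio; last exact: hlam.
  rewrite !hornerXsubC natrD; have := poch_neq0 1 (hlam l ll).
  rewrite pochS poch0 mul1r addr0; move: (q.+1%:R : K) (n%:R : K) => y z l0.
  by field.
have h_tail n : h (q.+1 + n)%N = T * (pFq_coeff a2 b2 n * (- x) ^+ n).
  have a2b2 : pFq_coeff a2 b2 n = (poch (c + q.+1%:R) n)^-1 *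
      \prod_(l <- lam) (poch (l + q.+2%:R) n / poch (l + q.+1%:R) n).
    rewrite /pFq_coeff !big_cons !big_map c_shift prodf_div.
    (* The upper parameter 1 gives [(1)_n = n!], cancelling the factorial of the series. *)
    have := poch_nat K 0 n; rewrite mul1r add0n => ->.
    rewrite -mulf_div mulrC !mulrA mulVf ?fact_neq0//.
    by rewrite mul1r.
  have := @Rpoly_tail K r f ms b q (q.+1 + n) hf qm (leq_addr _ _).
  rewrite -/m Rval hE a2b2 /T exprD pochD.
  set sm := \sum_(k < _) _; move=> smE.
  have arrange (y z w v : K) : y / z * (w * v) = y * w * (v / z) by ring.
  by rewrite arrange smE !invfM; ring.
have : (series h @ \oo --> S + T * pFq a2 b2 (- x))%classic.
  (* After a shift by [q + 1], every partial sum contains the whole head [S]; uniqueness of limits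
     then compares this value with the Cauchy product. *)
  rewrite -(cvg_shiftn q.+1).
  rewrite (_ : (fun n => _) = (fun n =>
      S + T * series (fun n => pFq_coeff a2 b2 n * (- x) ^+ n) n)).
    apply: cvgD; first exact: cvg_cst.
    by apply: cvgM; [exact: cvg_cst|exact: hK gt].
  apply/funext => n; rewrite /series/= (@big_cat_nat _ _ _ q.+1)//= ?leq_addl//.
  rewrite h_head; congr (_ + _); rewrite mulr_sumr.
  rewrite -{1}[q.+1]add0n big_addn addnK; apply: eq_bigr => i _.
  by rewrite addnC h_tail.
move=> cvg2; rewrite mulrC; exact: (cvg_unique (@norm_hausdorff _ K) cvg1 cvg2).
Qed.

Theorem theorem2 (R : realType) (b : R[i]) (r : nat) (hr : (0 < r)%N)
    (ms : 'I_r -> nat) (hms : forall j, (0 < ms j)%N)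
    (m : nat) (hm : m = (\sum_(j < r) ms j)%N)
    (f : 'I_r -> R[i]) (hf : forall j, ~ nonpos_int (f j))
    (q : nat) (hq : (q < m)%N)
    (hb : ~ nonpos_int (b + (m - q)%:R))
    (hfb : forall j : 'I_r, m%:Z - q%:Z - (ms j)%:Z <= 0 ->
       forall k : int, m%:Z - q%:Z - (ms j)%:Z <= k <= 0 -> f j - b <> k%:~R) :
  (Rpoly f ms b m q).[- q%:R - 1] =
    (-1) ^+ (m - q + 1) *
    \sum_(k < q.+2) poch b k * millerC f ms k * (-1) ^+ k *
      poch (k%:R - m%:R) (m - q - 1)
  /\
  forall (kappa : R[i]) (lam : (m - q - 1).-tuple R[i]),
    kappa <> 0 ->
    Rpoly f ms b m q = kappa *: \prod_(l <- lam) ('X - l%:P) ->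
    (forall i, ~ nonpos_int (tnth lam i + q.+1%:R)) ->
  forall x : R[i],
    expC (- x) *
      pFq (b :: [seq f j + (ms j)%:R | j : 'I_r])
          (b + (m - q)%:R :: [seq f j | j : 'I_r]) x =
    \sum_(j < q.+1)
      poch (- q%:R) j * Qval f ms b m q j /
        (poch (b + (m - q)%:R) j * j`!%:R) * (- x) ^+ j +
    (- x) ^+ q.+1 * (Rpoly f ms b m q).[- q%:R - 1] /
      (poch (b + (m - q)%:R) q.+1 * (m - q - 1)`!%:R) *
      pFq (1 :: [seq l + q.+2%:R | l <- lam])
          (b + m%:R + 1 :: [seq l + q.+1%:R | l <- lam]) (- x).
Proof.
subst m; split; first exact: Rpoly_first_tail.
move=> kappa lam _ hR hlam x.
apply: kummer_miller hR _ => //; first exact: exp_complete_complex.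
by move=> l /tnthP[i ->]; exact: hlam.
Qed.
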